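(* Let $G$ be an OAT graph on $n$ vertices and let $k$ be a positive integer such that $G$ is $k$-colourable. Then the reconfiguration graph $\mathcal{R}_{k+1}(G)$ is connected and has diameter at most $4n^2$.
   Context: All graphs are finite and simple. A $k$-colouring of $G$ is a map $c:V(G)\to\mathcal{S}$ with $|\mathcal{S}|\le k$ and $c(u)\ne c(v)$ for adjacent $u,v$. $\mathcal{R}_{k}(G)$ is the graph whose vertices are the proper colourings $V(G)\to\{1,\dots,k\}$, two colourings being adjacent iff they differ on exactly one vertex. For non-adjacent vertices $u,v$, $u$ is comparable to $v$ if $N(u)\subseteq N(v)$. A graph is an OAT graph if it can be constructed from single-vertex graphs by a finite sequence of the following operations, where $G_1=(V_1,E_1)$, $G_2=(V_2,E_2)$ are vertex-disjoint OAT graphs: (1) disjoint union $(V_1\cup V_2,E_1\cup E_2)$; (2) join $(V_1\cup V_2, E_1\cup E_2\cup\{xy: x\in V_1,y\in V_2\})$; (3) adding a comparable vertex: for $v\in V_1$ and a new vertex $u\notin V_1$, form $(V_1\cup\{u\}, E_1\cup\{ux: x\in X\})$ for some $X\subseteq N(v)$; (4) attaching a clique: for a complete graph $Q=(V_Q,E_Q)$ disjoint from $G_1$ and $v\in V_1$, form $(V_1\cup V_Q, E_1\cup E_Q\cup\{qv: q\in V_Q\})$. *)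

(* Defs.v *)
From mathcomp Require Import all_boot.

Set Implicit Arguments.
Unset Strict Implicit.
Unset Printing Implicit Defensive.

Record sgraph := SGraph {
  vertex :> finType;
  adj : rel vertex;
  adj_sym : symmetric adj;
  adj_irrefl : irreflexive adj
}.

Definition isomorphic (G H : sgraph) : Prop :=
  exists2 f : G -> H, bijective f & forall x y, adj (f x) (f y) = adj x y.

Definition neighbours (G : sgraph) (v : G) : {set G} := [set x | adj v x].

Section Operations.
Variables G H : sgraph.

Definition union_adj (a b : G + H) : bool :=
  match a, b with
  | inl x, inl y => adj x y
  | inr x, inr y => adj x y
  | _, _ => false
  end.

Lemma union_adj_sym : symmetric union_adj.
Proof. by move=> [x|x] [y|y] //=; rewrite adj_sym. Qed.

Lemma union_adj_irrefl : irreflexive union_adj.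
Proof. by move=> [x|x] /=; rewrite adj_irrefl. Qed.

Definition disjoint_union : sgraph := SGraph union_adj_sym union_adj_irrefl.

Definition join_adj (a b : G + H) : bool :=
  match a, b with
  | inl x, inl y => adj x y
  | inr x, inr y => adj x y
  | _, _ => true
  end.

Lemma join_adj_sym : symmetric join_adj.
Proof. by move=> [x|x] [y|y] //=; rewrite adj_sym. Qed.

Lemma join_adj_irrefl : irreflexive join_adj.
Proof. by move=> [x|x] /=; rewrite adj_irrefl. Qed.

Definition join : sgraph := SGraph join_adj_sym join_adj_irrefl.

End Operations.

(* The new vertex is [None]. *)
Section AddVertex.
Variables (G : sgraph) (X : {set G}).

Definition add_adj (a b : option G) : bool :=
  match a, b with
  | Some x, Some y => adj x y
  | Some x, None | None, Some x => x \in X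
  | None, None => false
  end.

Lemma add_adj_sym : symmetric add_adj.
Proof. by move=> [x|] [y|] //=; rewrite adj_sym. Qed.

Lemma add_adj_irrefl : irreflexive add_adj.
Proof. by move=> [x|] //=; rewrite adj_irrefl. Qed.

Definition add_vertex : sgraph := SGraph add_adj_sym add_adj_irrefl.

End AddVertex.

Section AttachClique.
Variables (G : sgraph) (v : G) (Q : finType).

Definition attach_adj (a b : G + Q) : bool :=
  match a, b with
  | inl x, inl y => adj x y
  | inr p, inr q => p != q
  | inl x, inr _ | inr _, inl x => x == v
  end.

Lemma attach_adj_sym : symmetric attach_adj.
Proof. by move=> [x|x] [y|y] //=; rewrite 1?adj_sym 1?eq_sym. Qed.

Lemma attach_adj_irrefl : irreflexive attach_adj.
Proof. by move=> [x|x] /=; rewrite ?adj_irrefl ?eqxx. Qed.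

Definition attach_clique : sgraph := SGraph attach_adj_sym attach_adj_irrefl.

End AttachClique.

(* The operations are realised on concrete vertex types ([G + H], [option G]),
   so closure under isomorphism makes the class independent of that choice. *)
Inductive OAT : sgraph -> Prop :=
  | OAT_single (G : sgraph) : #|G| = 1 -> OAT G
  | OAT_union (G H : sgraph) : OAT G -> OAT H -> OAT (disjoint_union G H)
  | OAT_join (G H : sgraph) : OAT G -> OAT H -> OAT (join G H)
  | OAT_comparable (G : sgraph) (v : G) (X : {set G}) :
      OAT G -> X \subset neighbours v -> OAT (add_vertex X)
  | OAT_clique (G : sgraph) (v : G) (Q : finType) :
      OAT G -> OAT (attach_clique v Q)
  | OAT_iso (G H : sgraph) : OAT G -> isomorphic G H -> OAT H.

Definition proper (G : sgraph) (S : eqType) (c : G -> S) : bool :=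
  [forall u, forall v, adj u v ==> (c u != c v)].

Definition colourable (k : nat) (G : sgraph) : Prop :=
  exists (S : finType) (c : G -> S), #|S| <= k /\ proper c.

Section Reconfiguration.
Variables (k : nat) (G : sgraph).

Definition colouring : finType := {c : {ffun G -> 'I_k} | proper c}.

Definition reconf_adj (c d : colouring) : bool :=
  #|[set v | val c v != val d v]| == 1.

Lemma reconf_adj_sym : symmetric reconf_adj.
Proof.
move=> c d; rewrite /reconf_adj; congr (_ == 1).
by apply: eq_card => v; rewrite !inE eq_sym.
Qed.

Lemma reconf_adj_irrefl : irreflexive reconf_adj.
Proof.
move=> c; rewrite /reconf_adj (_ : [set v | _] = set0) ?cards0 //.
by apply/setP=> v; rewrite !inE eqxx.
Qed.

Definition reconf : sgraph := SGraph reconf_adj_sym reconf_adj_irrefl.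

End Reconfiguration.

Definition connected (G : sgraph) : Prop :=
  0 < #|G| /\ forall x y : G, connect (@adj G) x y.

Definition walk (G : sgraph) (x y : G) (n : nat) : bool :=
  [exists p : n.-tuple G, path (@adj G) x p && (last x p == y)].

(* The least length of a walk from [x] to [y]; the search is bounded by #|G|
   because a shortest walk is a path. When [y] is not reachable from [x] this
   is #|G|, so [diameter] is only meaningful for a connected graph. *)
Definition dist (G : sgraph) (x y : G) : nat :=
  find (walk x y) (iota 0 #|G|).

Definition diameter (G : sgraph) : nat :=
  \max_(x : G) \max_(y : G) dist x y.

Lemma walkP (G : sgraph) (x y : G) n :
  reflect (exists p, [/\ path (@adj G) x p, last x p = y & size p = n])
          (walk x y n).
Proof.
apply: (iffP existsP) => [[p /andP[pp /eqP lp]]|[p [pp lp sp]]].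
  by exists p; rewrite size_tuple.
have sp' : size p == n by apply/eqP.
by exists (Tuple sp'); rewrite /= pp lp eqxx.
Qed.

Lemma dist_min (G : sgraph) (x y : G) n : walk x y n -> dist x y <= n.
Proof.
move=> w; rewrite leqNgt; apply/negP=> lt_n.
have lt_s : n < #|G|.
  by apply: leq_trans lt_n _; rewrite -[X in _ <= X](size_iota 0) find_size.
by have := before_find 0 lt_n; rewrite nth_iota // w.
Qed.

Lemma dist_walk (G : sgraph) (x y : G) :
  connect (@adj G) x y -> walk x y (dist x y).
Proof.
case/connectP=> p pp ->; case/shortenP: pp => q qq uq _.
have lt_q : size q < #|G| by rewrite -[(size q).+1]/(size (x :: q)) -(card_uniqP uq) max_card.
have hw : has (walk x (last x q)) (iota 0 #|G|).
  apply/hasP; exists (size q); first by rewrite mem_iota.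
  by apply/walkP; exists q.
have := nth_find 0 hw; rewrite nth_iota //.
by move: hw; rewrite has_find size_iota.
Qed.

(* Main.v *)
(** An OAT graph [G] on [n] vertices has a fixed optimal colouring, with [m]
colours say, such that every colouring from a palette of more than [m] colours
reaches it up to a renaming of the colours, each vertex moving at most [2n-1]
times; this is an induction on the construction of [G].  In a join one of the
two parts sees enough colours to be reduced first, and this frees enough
colours for the other; each vertex moves only inside its own part, so the
budgets do not add up.  A comparable vertex first copies [v] and then shadows
it.  A clique shadows [v] by stepping aside whenever [v] takes one of its
colours.  In a disjoint union the two parts only have to agree on the names.

With one spare colour any renaming costs at most two moves per vertex.  Going
from one colouring to the canonical one, renaming, and going back along the
path of the other colouring, each vertex moves at most
[2(2n-1) + 2 = 4n] times, hence [4n^2] moves in total. *)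

From mathcomp Require Import all_boot zify.
Require Import Defs.

Set Implicit Arguments.
Unset Strict Implicit.
Unset Printing Implicit Defensive.

(** * Proper colourings and homomorphisms *)

Lemma properP (G : sgraph) (S : eqType) (c : G -> S) :
  reflect (forall u v, adj u v -> c u != c v) (proper c).
Proof.
apply: (iffP forallP) => [h u v e|h u].
  by move: (h u) => /forallP/(_ v)/implyP; apply.
by apply/forallP => v; apply/implyP; apply: h.
Qed.

Lemma inj_proper (G : sgraph) (S : eqType) (c : G -> S) :
  injective c -> proper c.
Proof.
move=> ci; apply/properP => u v e; rewrite (inj_eq ci).
by apply: contraTneq e => ->; rewrite adj_irrefl.
Qed.

Lemma proper_hom (G H : sgraph) (S : eqType) (h : G -> H) (c : H -> S) :
  (forall x y, adj x y -> adj (h x) (h y)) -> proper c -> proper (c \o h).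
Proof. by move=> hh /properP cp; apply/properP => x y /hh; apply: cp. Qed.

(** * Recolouring sequences with a budget for each vertex *)

(* Each vertex [x] may move at most [w x] times. A move may keep the colour, and
   colourings are compared pointwise in place of functional extensionality. *)
Inductive recol (G : sgraph) (C : finType) (A : {set C}) :
    (G -> nat) -> (G -> C) -> (G -> C) -> Prop :=
  | recol_refl w f g : f =1 g -> recol A w f g
  | recol_step w w' f f' g v :
      (forall x, x != v -> f' x = f x) -> f' v \in A -> proper f' ->
      (forall x, w' x + (x == v) <= w x) ->
      recol A w' f' g -> recol A w f g.

Section Recol.
Variables (G : sgraph) (C : finType) (A : {set C}).
Implicit Types (w : G -> nat) (f g : G -> C).

Lemma recol_eql w f f' g : f =1 f' -> recol A w f g -> recol A w f' g.
Proof.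
move=> ff' r; case: r ff' => [{}w {}f {}g fg|{}w w' {}f f1 {}g v f1f Av p lw r] ff'.
  by apply: recol_refl => x; rewrite -ff'.
by apply: recol_step Av p lw r => x /f1f ->.
Qed.

Lemma recol_trans w1 w2 w f g h : (forall x, w1 x + w2 x <= w x) ->
  recol A w1 f g -> recol A w2 g h -> recol A w f h.
Proof.
move=> lw r; elim: r w lw => {w1 f g} [w1 f g fg|w1 w1' f f1 g v f1f Av p l1 _ IH] w lw r.
  have /(recol_eql (f' := f)) : recol A w g h; last by apply=> x; rewrite fg.
  case: r lw => [w' f' g' e|w' w'' f' f1 g' v e Av p l r] lw.
    exact: recol_refl.
  apply: recol_step e Av p _ r => x; move: (l x) (lw x); lia.
apply: (recol_step (w' := fun x => w x - (x == v)) f1f Av p) => [x|].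
  by move: (lw x) (l1 x); lia.
by apply: IH r => x; move: (lw x) (l1 x); lia.
Qed.

Lemma recol_mono w w' f g :
  (forall x, w x <= w' x) -> recol A w f g -> recol A w' f g.
Proof.
move=> lw r; apply: (@recol_trans w (fun _ => 0)) r _ => [x|].
  by rewrite addn0.
exact: recol_refl.
Qed.

Lemma recol_eqr w f g g' : g =1 g' -> recol A w f g -> recol A w f g'.
Proof.
move=> gg' r; apply: (@recol_trans w (fun _ => 0)) r _ => [x|].
  by rewrite addn0.
exact: recol_refl.
Qed.

(** The moves are undone in reverse order. Undoing one may restore a colour of [f], while the
    sequence itself only places the new colours in [A]; hence the hypothesis on [f]. *)
Lemma recol_sym w f g : proper f -> (forall x, f x \in A) ->
  recol A w f g -> recol A w g f.
Proof.
move=> pf fA r; elim: r pf fA => {w f g} [w f g fg _ _|w w' f f1 g v f1f Av p lw _ IH pf fA].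
  by apply: recol_refl => x; rewrite fg.
apply: (recol_trans lw).
  by apply: IH => // x; case: (eqVneq x v) => [->|/f1f ->].
apply: (recol_step (w' := fun _ => 0) (v := v) (f' := f)) => //.
- by move=> x /f1f ->.
- exact: recol_refl.
Qed.

(** No edge has the [f]-colour of one end equal to the [g]-colour of the other, so every mixture of
    [f] and [g] is proper and the vertices can switch one by one in any order. *)
Lemma recol_mix f g : proper f -> proper g ->
  (forall x y, adj x y -> f x != g y) -> (forall x, f x != g x -> g x \in A) ->
  recol A (fun x => f x != g x) f g.
Proof.
move=> pf /properP pg fg gA.
elim: {f}#|_| {-2}f (erefl #|[set x | f x != g x]|) pf fg gA => [|n IH] f.
  move/eqP; rewrite cards_eq0 => /eqP e _ _ _; apply: recol_refl => x.
  by apply/eqP; move/setP: e => /(_ x); rewrite !inE => /negbFE.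
move=> cn /properP pf fg gA.
have /card_gt0P [v] : 0 < #|[set x | f x != g x]| by rewrite cn.
rewrite inE => fgv.
pose f' x := if x == v then g v else f x.
have pf' : proper f'.
  apply/properP => x y e; rewrite /f'; case: (eqVneq x v) => [xv|_]; case: (eqVneq y v) => [yv|_].
  - by move: e; rewrite xv yv adj_irrefl.
  - by rewrite eq_sym fg // adj_sym -xv.
  - by rewrite -yv fg.
  - exact: pf.
have ff' x : x != v -> f' x = f x by rewrite /f' => /negbTE ->.
have f'v : f' v = g v by rewrite /f' eqxx.
apply: (recol_step (w' := fun x => f' x != g x) (v := v) ff') => //.
- by rewrite f'v gA.
- by move=> x; case: (eqVneq x v) => [->|/ff' ->]; rewrite ?f'v ?eqxx ?fgv ?addn0.
apply: IH => //.
- move: cn; rewrite (cardsD1 v) inE fgv => -[<-]; apply: eq_card => x.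
  by rewrite !inE; case: (eqVneq x v) => [->|/ff' ->]; rewrite ?f'v ?eqxx.
- move=> x y e; case: (eqVneq x v) => [xv|/ff' -> //]; last exact: fg.
  by rewrite xv f'v pg // -xv.
- by move=> x; case: (eqVneq x v) => [->|/ff' ->]; rewrite ?f'v ?eqxx //; apply: gA.
Qed.

End Recol.

(** * Transport along homomorphisms and embeddings *)

(** A move at [v] lifts to a move of the whole fibre of [v]. The fibre is independent because [H]
    has no loops, so its vertices can move one after another. *)
Lemma recol_hom (G H : sgraph) (C : finType) (A : {set C}) (h : G -> H) w f g :
  (forall x y, adj x y -> adj (h x) (h y)) -> proper f ->
  @recol H C A w f g -> recol A (w \o h) (f \o h) (g \o h).
Proof.
move=> hh pf r; elim: r pf => {w f g} [w f g fg _|w w' f f1 g v f1f Av p lw _ IH pf].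
  by apply: recol_refl => x /=; rewrite fg.
apply: (recol_trans (w1 := fun x => h x == v) _ _ (IH p)) => [x|].
  by rewrite /= addnC.
apply: (recol_mono (w := fun x => (f \o h) x != (f1 \o h) x)).
  by move=> x /=; case: (eqVneq (h x) v) => [_|/f1f ->]; rewrite ?leq_b1 ?eqxx.
apply: recol_mix; try exact: proper_hom.
  move=> x y /hh e /=; case: (eqVneq (h y) v) => [yv|/f1f ->].
    rewrite -f1f; first by apply: (properP _ p).
    by apply: contraTneq e => ->; rewrite yv adj_irrefl.
  exact: (properP _ pf).
by move=> x /=; case: (eqVneq (h x) v) => [->|/f1f ->]; rewrite ?eqxx.
Qed.

(** The moves are replayed in [H] with everything outside the image of [i] fixed. Each move goes to
    a colour of [A], and no outside neighbour has such a colour, so no conflict arises. *)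
Lemma recol_embed (G H : sgraph) (C : finType) (A B : {set C}) (i : G -> H)
    w W (F : H -> C) g :
  injective i -> (forall x y, adj (i x) (i y) -> adj x y) -> A \subset B ->
  (forall x, w x <= W (i x)) -> proper F ->
  (forall x y, y \notin codom i -> adj (i x) y -> F y \notin A) ->
  recol A w (F \o i) g ->
  exists F', [/\ recol B W F F', proper F', F' \o i =1 g
    & forall y, y \notin codom i -> F' y = F y].
Proof.
move=> inj_i ai AB lW pF FA rF.
have [f Ff r] : exists2 f, F \o i =1 f & recol A w f g by exists (F \o i).
clear rF.
elim: r W lW F pF FA Ff => {w f g} [w f g fg|w w' f f1 g v f1f Av p lw _ IH] W lW F pF FA Ff.
  exists F; split=> //; first exact: recol_refl.
  by move=> x; rewrite -fg Ff.
pose F1 y := if y == i v then f1 v else F y.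
have F1v : F1 (i v) = f1 v by rewrite /F1 eqxx.
have F1n y : y != i v -> F1 y = F y by rewrite /F1 => /negbTE ->.
have F1i : F1 \o i =1 f1.
  move=> x /=; case: (eqVneq x v) => [->//|xv].
  by rewrite f1f // F1n ?inj_eq //; apply: Ff.
have F1o y : y \notin codom i -> F1 y = F y.
  by move=> yi; apply: F1n; apply: contraNneq yi => ->; apply: codom_f.
have vP y : adj (i v) y -> f1 v != F1 y.
  move=> e; case: (boolP (y \in codom i)) => [/codomP[z zi]|yi].
    by subst y; move: (F1i z) => /= ->; apply: (properP _ p); apply: ai.
  by rewrite F1o //; apply: contraNneq (FA v y yi e) => <-.
have pF1 : proper F1.
  apply/properP => x y e; case: (eqVneq x (i v)) => [xv|xv].
    by rewrite xv F1v vP // -xv.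
  case: (eqVneq y (i v)) => [yv|yv].
    by rewrite eq_sym yv F1v vP // adj_sym -yv.
  by rewrite !F1n //; apply: (properP _ pF).
have [||| F' [r pF' F'i F'o]] := IH (fun y => W y - (y == i v)) _ F1 pF1.
- by move=> x; rewrite (inj_eq inj_i); move: (lw x) (lW x); lia.
- by move=> x y yi; rewrite F1o //; apply: FA.
- exact: F1i.
exists F'; split=> // [|y yi]; last by rewrite F'o // F1o.
apply: (recol_step F1n _ pF1 _ r).
  by rewrite F1v (subsetP AB).
move=> y; case: (eqVneq y (i v)) => [->|_]; last by rewrite subn0 addn0.
by rewrite subnK //; move: (lw v) (lW v); rewrite eqxx; lia.
Qed.

(** * Renaming the colours *)

(* If no vertex can move directly to its target, a vertex that blocks a target
   is parked on a spare colour, which then is nobody's target, so it never has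
   to be parked again; hence two moves per vertex. *)
Lemma recol_inj (G : sgraph) (C : finType) (A : {set C}) (f g : G -> C) :
  injective f -> injective g ->
  (forall x, g x \in A) -> #|G| < #|A| ->
  recol A (fun _ => 2) f g.
Proof.
move=> fi gi gA ltA.
(* The moves that [x] may still need: none at its target, two on a colour that is some target, since
   [x] may have to be parked, and one otherwise. *)
pose cost f x := if f x == g x then 0 else if f x \in codom g then 2 else 1.
suff : recol A (cost f) f g.
  by apply: recol_mono => x; rewrite /cost; case: ifP => // _; case: ifP.
have [n] := ubnP (\sum_x cost f x).
elim: n f fi => // n IH f fi lts.
(* It suffices to find one move to a free colour of [A] that lowers the cost of its vertex. *)
have move_one v c : c \in A -> c \notin codom f ->
    (if c == g v then 0 else if c \in codom g then 2 else 1) < cost f v ->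
    recol A (cost f) f g.
  move=> cA cf ltc; pose f' x := if x == v then c else f x.
  have f'v : f' v = c by rewrite /f' eqxx.
  have f'n x : x != v -> f' x = f x by rewrite /f' => /negbTE ->.
  have f'i : injective f'.
    move=> x y; rewrite /f'; case: (eqVneq x v) => [->|_]; case: (eqVneq y v) => [->|_] //.
    - by move=> e; move: cf; rewrite e codom_f.
    - by move=> e; move: cf; rewrite -e codom_f.
    - exact: fi.
  have costv : cost f' v < cost f v by rewrite {1}/cost f'v.
  have costn x : x != v -> cost f' x = cost f x by move=> xv; rewrite /cost f'n.
  apply: (recol_step (w' := cost f') f'n).
  - by rewrite f'v.
  - exact: inj_proper.
  - by move=> x; case: (eqVneq x v) => [->|/costn ->]; lia.
  apply: IH => //.
  have sumn : \sum_(x | x != v) cost f' x = \sum_(x | x != v) cost f x.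
    by apply: eq_bigr => x /costn.
  by move: lts; rewrite (bigD1 v) //= [X in _ -> X < _](bigD1 v) //= sumn; lia.
case: (pickP (fun x => (f x != g x) && (g x \notin codom f))) => [v /andP[fgv gv]|no1].
  apply: (move_one v (g v)) => //.
  by rewrite eqxx /cost (negbTE fgv); case: ifP.
case: (pickP (fun x => f x != g x)) => [x fgx|no2]; last first.
  by apply: recol_refl => x; apply/eqP; move/negbFE: (no2 x).
have /codomP[y gxy] : g x \in codom f by move: (no1 x); rewrite fgx => /negbFE.
have yx : y != x by apply: contraNneq fgx => e; rewrite gxy e.
have /subsetPn[d dA df] : ~~ (A \subset codom f).
  by apply/negP => /subset_leq_card; rewrite card_codom // leqNgt ltA.
(* A vertex with target [d] would either sit on it already or be free to move there; both are
   excluded. *)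
have dg : d \notin codom g.
  apply/negP => /codomP[z dz]; move: (no1 z); rewrite -dz df andbT => /negbFE/eqP e.
  by move: df; rewrite -e codom_f.
apply: (move_one y d) => //.
(* The blocking vertex [y] sits on the target of [x], so parking it on [d] lowers its cost from two
   to one. *)
have /negbTE fgy : f y != g y by rewrite -gxy (inj_eq gi) eq_sym.
rewrite (negbTE dg) /cost fgy -gxy codom_f.
by case: eqP.
Qed.

Definition complete_adj (Q : finType) (p q : Q) := p != q.

Lemma complete_sym (Q : finType) : symmetric (@complete_adj Q).
Proof. by move=> p q; rewrite /complete_adj eq_sym. Qed.

Lemma complete_irrefl (Q : finType) : irreflexive (@complete_adj Q).
Proof. by move=> p; rewrite /complete_adj eqxx. Qed.

Definition complete (Q : finType) : sgraph :=
  SGraph (@complete_sym Q) (@complete_irrefl Q).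

(** The colouring [c] is a homomorphism [h] into the complete graph on [m] vertices. The renaming is
    done there by [recol_inj] and pulled back along [h]. *)
Lemma recol_rename (G : sgraph) (C : finType) (A : {set C}) x0 m
    (c : G -> nat) (s t : seq C) :
  proper c -> (forall x, c x < m) -> m < #|A| ->
  uniq s -> s =i A -> uniq t -> t =i A ->
  recol A (fun _ => 2) (fun x => nth x0 s (c x)) (fun x => nth x0 t (c x)).
Proof.
move=> /properP pc cm ltA us sA ut tA.
pose h x : complete 'I_m := Ordinal (cm x).
have hh x y : adj x y -> adj (h x) (h y) by apply: pc.
have sz (r : seq C) : uniq r -> r =i A -> size r = #|A|.
  by move=> /card_uniqP <- e; apply: eq_card.
have ni (r : seq C) : uniq r -> r =i A -> injective (fun i : complete 'I_m => nth x0 r i).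
  move=> ur rA i j /eqP; rewrite nth_uniq ?(sz r) // => [/eqP/val_inj //||].
    exact: ltn_trans (ltn_ord i) ltA.
  exact: ltn_trans (ltn_ord j) ltA.
have nA (r : seq C) : uniq r -> r =i A -> forall i : complete 'I_m, nth x0 r i \in A.
  by move=> ur rA i; rewrite -rA mem_nth // (sz r) // (ltn_trans (ltn_ord i) ltA).
have := recol_inj (ni s us sA) (ni t ut tA) (nA t ut tA).
rewrite card_ord => /(_ ltA) /(recol_hom hh); apply.
exact/inj_proper/ni.
Qed.

(** * Canonical colourings *)

(** Here [m] is the chromatic number and [c] the fixed optimal colouring. The list [s] encodes the
    renaming: colour [i] becomes entry [i] of an enumeration of the palette [A]. It may depend on
    [f]. The default [x0] is never read, as [m < #|A|]. *)
Definition canonical (G : sgraph) m (c : G -> nat) : Prop :=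
  [/\ 0 < #|G|, proper c, forall x, c x < m,
      forall (C : finType) (f : G -> C), proper f -> m <= #|codom f|
    & forall (C : finType) (A : {set C}) (x0 : C) (f : G -> C),
      proper f -> (forall x, f x \in A) -> m < #|A| ->
      exists s, [/\ uniq s, s =i A
        & recol A (fun _ => (2 * #|G|).-1) f (fun x => nth x0 s (c x))]].

(** With the list [s] prescribed, a renaming follows the reduction: [(2n-1) + 2 = 2n+1]. *)
Lemma canonical_recol (G : sgraph) m (c : G -> nat) (C : finType)
    (A : {set C}) x0 (f : G -> C) s :
  canonical m c -> proper f -> (forall x, f x \in A) -> m < #|A| ->
  uniq s -> s =i A ->
  recol A (fun _ => (2 * #|G|).+1) f (fun x => nth x0 s (c x)).
Proof.
move=> [G0 pc cm _ red] pf fA ltA us sA; have [t [ut tA r]] := red C A x0 f pf fA ltA.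
apply: recol_trans r (recol_rename x0 pc cm ltA ut tA us sA) => _; lia.
Qed.

Lemma enum_uniqE (C : finType) (A : {set C}) : uniq (enum A) /\ enum A =i A.
Proof. by split; [exact: enum_uniq|exact: mem_enum]. Qed.

(** * Single vertices, isomorphic copies and disjoint unions *)

Lemma canonical_single (G : sgraph) : #|G| = 1 -> canonical 1 (fun _ : G => 0).
Proof.
move=> G1; have e1 (x y : G) : x = y.
  by apply: (@card_le1_eqP G predT); rewrite ?G1.
have noadj (x y : G) : adj x y = false by rewrite (e1 x y) adj_irrefl.
have pr (S : eqType) (f : G -> S) : proper f.
  by apply/properP => x y; rewrite noadj.
split=> // [|C f _|C A x0 f _ fA ltA]; first by rewrite G1.
  have /card_gt0P[x _] : 0 < #|G| by rewrite G1.
  by apply/card_gt0P; exists (f x); apply: codom_f.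
have [us sA] := enum_uniqE A; exists (enum A); split=> //.
apply: (recol_mono (w := fun x => f x != nth x0 (enum A) 0)).
  by move=> x; rewrite G1 leq_b1.
apply: recol_mix => [||x y|x _]; rewrite ?pr ?noadj //.
by rewrite -sA mem_nth // -cardE (ltn_trans _ ltA).
Qed.

Lemma canonical_iso (G H : sgraph) m (c : G -> nat) :
  isomorphic G H -> canonical m c -> exists c' : H -> nat, canonical m c'.
Proof.
move=> [h [g hK gK] hh] [G0 pc cm lb red]; exists (c \o g).
have gh x y : adj x y -> adj (g x) (g y) by rewrite -{1}[x]gK -{1}[y]gK hh.
have cGH : #|G| = #|H| by apply: bij_eq_card; exists g.
have ph (S : eqType) (f : H -> S) : proper f -> proper (f \o h).
  by apply: proper_hom => x y; rewrite hh.
split=> [||x|C f pf|C A x0 f pf fA ltA].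
- by rewrite -cGH.
- exact: proper_hom.
- exact: cm.
- apply: leq_trans (lb _ _ (ph _ f pf)) _; apply: subset_leq_card.
  by apply/subsetP => _ /codomP[x ->]; apply: codom_f.
have [s [us sA r]] := red C A x0 _ (ph _ f pf) (fun x => fA (h x)) ltA.
exists s; split=> //; rewrite -cGH.
apply: recol_eql (recol_hom gh (ph _ f pf) r) => x /=.
by rewrite gK.
Qed.

Section Union.
Variables G H : sgraph.

(** Both parts are brought to the same list [enum A]. A vertex of [G] needs [2|G|+1] moves, which is
    at most [2(|G|+|H|)-1] because [H] is nonempty; likewise for [H]. *)
Lemma canonical_union m1 (c1 : G -> nat) m2 (c2 : H -> nat) :
  canonical m1 c1 -> canonical m2 c2 ->
  exists c : disjoint_union G H -> nat, canonical (maxn m1 m2) c.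
Proof.
move=> can1 can2; have [G0 pc1 cm1 lb1 _] := can1; have [H0 pc2 cm2 lb2 _] := can2.
exists (fun z : G + H => match z with inl x => c1 x | inr y => c2 y end).
have pl (S : eqType) (f : disjoint_union G H -> S) : proper f -> proper (f \o inl).
  exact: proper_hom.
have pr (S : eqType) (f : disjoint_union G H -> S) : proper f -> proper (f \o inr).
  exact: proper_hom.
have cGH : #|disjoint_union G H| = #|G| + #|H| by rewrite card_sum.
split=> [||x|C f pf|C A x0 f pf fA]; rewrite ?cGH.
- by rewrite addn_gt0 G0.
- by apply/properP => -[x|x] [y|y] //=; apply/properP.
- by case: x => [x|x]; rewrite leq_max (cm1, cm2) ?orbT.
- rewrite geq_max; apply/andP; split.
    apply: leq_trans (lb1 _ _ (pl _ f pf)) _; apply: subset_leq_card.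
    by apply/subsetP => _ /codomP[x ->]; apply: codom_f.
  apply: leq_trans (lb2 _ _ (pr _ f pf)) _; apply: subset_leq_card.
  by apply/subsetP => _ /codomP[x ->]; apply: codom_f.
rewrite gtn_max => /andP[lt1 lt2]; have [us sA] := enum_uniqE A.
exists (enum A); split=> //.
pose W1 (z : disjoint_union G H) := if z is inl _ then (2 * #|G|).+1 else 0.
pose W2 (z : disjoint_union G H) := if z is inr _ then (2 * #|H|).+1 else 0.
have r1 := canonical_recol x0 can1 (pl _ f pf) (fun x => fA (inl x)) lt1 us sA.
have inlA (x : G) y : y \notin codom inl -> adj (inl x : disjoint_union G H) y -> f y \notin A.
  by case: y => // y; rewrite codom_f.
have inrA (x : H) y g : y \notin codom inr -> adj (inr x : disjoint_union G H) y -> g y \notin A.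
  by case: y => // y; rewrite codom_f.
have [F1 [R1 pF1 F1l F1r]] := @recol_embed _ (disjoint_union G H) _ _ _ _ _ W1 _ _
  (@inl_inj _ _) (fun x y => id) (subxx A) (fun x => leqnn _) pf inlA r1.
have r2 := canonical_recol x0 can2 (pr _ f pf) (fun x => fA (inr x)) lt2 us sA.
have F1r' : f \o inr =1 F1 \o inr.
  by move=> y /=; rewrite F1r //; apply/codomP => -[].
have [F2 [R2 pF2 F2r F2l]] := @recol_embed _ (disjoint_union G H) _ _ _ _ _ W2 _ _
  (@inr_inj _ _) (fun x y => id) (subxx A) (fun x => leqnn _) pF1
  (fun x y => @inrA x y F1) (recol_eql F1r' r2).
apply: recol_eqr (recol_trans _ R1 R2) => [[x|y]|[x|y]]; rewrite /W1 /W2; try lia.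
  by rewrite F2l; [exact: F1l|apply/codomP => -[]].
exact: F2r.
Qed.

End Union.

(** * Joins *)

(** The part [G] goes first, inside the more than [m1] colours absent from [H]. Afterwards it
    occupies at most [m1] colours, so more than [m2] are left for [H]. The embeddings [i] and [j]
    allow the two sides to be exchanged. *)
Lemma join_recol (J G H : sgraph) (i : G -> J) (j : H -> J)
    (C : finType) (A : {set C}) x0 m1 (c1 : G -> nat) m2 (c2 : H -> nat)
    (F : J -> C) :
  injective i -> injective j ->
  (forall x y, adj (i x) (i y) = adj x y) ->
  (forall x y, adj (j x) (j y) = adj x y) ->
  (forall x y, adj (i x) (j y)) ->
  (forall z, (z \in codom j) = (z \notin codom i)) ->
  canonical m1 c1 -> canonical m2 c2 ->
  proper F -> (forall z, F z \in A) ->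
  m1 + m2 < #|A| -> m1 < #|A :\: (F \o j) @: setT| ->
  exists t1 t2 F', [/\ uniq (t1 ++ t2), {subset t1 ++ t2 <= A},
    size t1 = m1 /\ size t2 = m2,
    (F' \o i =1 fun x => nth x0 t1 (c1 x)) /\
    (F' \o j =1 fun x => nth x0 t2 (c2 x))
    & recol A (fun _ => (2 * (#|G| + #|H|)).-1) F F'].
Proof.
move=> ii ij ai aj ij_adj ijC [G0 pc1 cm1 _ red1] [H0 pc2 cm2 _ red2] pF FA ltA.
set A1 := A :\: _ => ltA1.
have iadj x y : adj x y -> adj (i x) (i y) by rewrite ai.
have jadj x y : adj x y -> adj (j x) (j y) by rewrite aj.
have A1i x : (F \o i) x \in A1.
  rewrite inE FA andbT; apply/imsetP => -[y _ /= e].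
  by have := properP _ pF _ _ (ij_adj x y); rewrite e eqxx.
have [s1 [us1 s1A r1]] := red1 C A1 x0 _ (proper_hom iadj pF) A1i ltA1.
have FA1 x y : y \notin codom i -> adj (i x) y -> F y \notin A1.
  rewrite -ijC => /codomP[z ->] _; rewrite inE negb_and negbK.
  by apply/orP; left; apply/imsetP; exists z.
have iadj' x y : adj (i x) (i y) -> adj x y by rewrite ai.
have [F1 [R1 pF1 F1i F1o]] := recol_embed (W := fun _ => (2 * #|G|).-1)
  ii iadj' (subsetDl A _) (fun _ => leqnn _) pF FA1 r1.
(* As [c1] stays below [m1], only the first [m1] entries of [s1] are in use. *)
have sz1 : size (take m1 s1) = m1.
  rewrite size_takel // -(card_uniqP us1) (eq_card s1A); exact: ltnW.
have t1A1 z : z \in take m1 s1 -> z \in A1 by move/mem_take; rewrite s1A.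
have F1j y : F1 (j y) = F (j y) by rewrite F1o // -ijC codom_f.
pose A2 := A :\: [set z in take m1 s1].
have A2P z : (z \in A2) = (z \notin take m1 s1) && (z \in A) by rewrite !inE.
have A2j y : (F1 \o j) y \in A2.
  rewrite A2P /= F1j FA andbT; apply/negP => /t1A1; rewrite inE => /andP[/negP[]].
  by apply/imsetP; exists y.
have ltA2 : m2 < #|A2|.
  rewrite /A2 cardsD; have : #|A :&: [set z in take m1 s1]| <= m1.
    apply: leq_trans (subset_leq_card (subsetIr _ _)) _.
    by rewrite cardsE -[X in _ <= X]sz1 card_size.
  by lia.
have [s2 [us2 s2A r2]] := red2 C A2 x0 _ (proper_hom jadj pF1) A2j ltA2.
have F1A2 x y : y \notin codom j -> adj (j x) y -> F1 y \notin A2.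
  rewrite ijC negbK => /codomP[z ->] _; rewrite A2P negb_and negbK.
  apply/orP; left; have /= -> := F1i z.
  by rewrite -(nth_take x0 (cm1 z)) mem_nth // sz1.
have jadj' x y : adj (j x) (j y) -> adj x y by rewrite aj.
have [F2 [R2 pF2 F2j F2o]] := recol_embed (W := fun _ => (2 * #|H|).-1)
  ij jadj' (subsetDl A _) (fun _ => leqnn _) pF1 F1A2 r2.
have sz2 : size (take m2 s2) = m2.
  rewrite size_takel // -(card_uniqP us2) (eq_card s2A); exact: ltnW.
exists (take m1 s1), (take m2 s2), F2; split=> //.
- rewrite cat_uniq !take_uniq //= andbT; apply/hasPn => z /mem_take.
  by rewrite s2A A2P => /andP[].
- move=> z; rewrite mem_cat => /orP[/t1A1|/mem_take]; first by rewrite inE => /andP[].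
  by rewrite s2A A2P => /andP[].
- split=> x; last by rewrite F2j nth_take.
  rewrite /= F2o; last by rewrite ijC negbK codom_f.
  by have /= -> := F1i x; rewrite nth_take.
(* The sum [(2|G|-1) + (2|H|-1)] fits, so both phases can be charged to every vertex. *)
by apply: recol_trans R1 R2 => _; lia.
Qed.

Section Join.
Variables G H : sgraph.

Lemma canonical_join m1 (c1 : G -> nat) m2 (c2 : H -> nat) :
  canonical m1 c1 -> canonical m2 c2 ->
  exists c : join G H -> nat, canonical (m1 + m2) c.
Proof.
move=> can1 can2; have [G0 pc1 cm1 lb1 _] := can1; have [H0 pc2 cm2 lb2 _] := can2.
exists (fun z : G + H => match z with inl x => c1 x | inr y => m1 + c2 y end).
have cGH : #|join G H| = #|G| + #|H| by rewrite card_sum.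
have inl_hom (x y : G) : adj (inl x : join G H) (inl y) = adj x y by [].
have inr_hom (x y : H) : adj (inr x : join G H) (inr y) = adj x y by [].
have cross (S : eqType) (f : join G H -> S) : proper f -> forall x y, f (inl x) != f (inr y).
  by move=> /properP pf x y; apply: pf.
split=> [||x|C f pf|C A x0 f pf fA ltA]; rewrite ?cGH.
- by rewrite addn_gt0 G0.
- apply/properP => -[x|x] [y|y] //= e.
  + exact: (properP _ pc1).
  + by move: (cm1 x); lia.
  + by move: (cm1 y); lia.
  + by rewrite eqn_add2l; apply: (properP _ pc2).
- by case: x => [x|x]; [move: (cm1 x)|move: (cm2 x)]; lia.
- have pl : proper (f \o inl : G -> C) by apply: proper_hom pf.
  have pr : proper (f \o inr : H -> C) by apply: proper_hom pf.
  apply: leq_trans (leq_add (lb1 _ _ pl) (lb2 _ _ pr)) _.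
  pose B1 := [set z in codom (f \o inl : G -> C)].
  pose B2 := [set z in codom (f \o inr : H -> C)].
  have B12 : B1 :&: B2 = set0.
    apply/setP => z; rewrite !inE; apply/negP => /andP[/codomP[x ->] /codomP[y e]].
    by have := cross _ f pf x y; rewrite -[f (inr y)]e eqxx.
  rewrite -[X in X + _]cardsE -[X in _ + X]cardsE -/B1 -/B2 -cardsUI B12 cards0 addn0.
  apply: subset_leq_card; apply/subsetP => z; rewrite !inE.
  by case/orP => /codomP[x ->]; apply: codom_f.
suff [t1 [t2 [F' [ut tA [sz1 sz2] [Fl Fr] R]]]] : exists t1 t2 F', [/\ uniq (t1 ++ t2),
    {subset t1 ++ t2 <= A}, size t1 = m1 /\ size t2 = m2,
    (F' \o inl =1 fun x => nth x0 t1 (c1 x)) /\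
    (F' \o inr =1 fun x => nth x0 t2 (c2 x))
    & recol A (fun _ => (2 * (#|G| + #|H|)).-1) f F'].
  (* The remaining colours of [A] are appended to make a full enumeration; the colouring does not
     read them. *)
  exists ((t1 ++ t2) ++ [seq z <- enum A | z \notin t1 ++ t2]); split.
  - rewrite cat_uniq ut filter_uniq ?enum_uniq // andbT /=.
    by apply/hasPn => z; rewrite mem_filter => /andP[].
  - move=> z; rewrite mem_cat mem_filter mem_enum.
    by case: (boolP (z \in t1 ++ t2)) => [/tA ->|].
  apply: recol_eqr R => -[x|y]; rewrite -catA nth_cat sz1.
    by rewrite cm1; apply: Fl.
  rewrite ltnNge leq_addr /= addKn nth_cat sz2 cm2; exact: Fr.
have ijC (z : join G H) : (z \in codom inr) = (z \notin codom inl).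
  case: z => z; first by rewrite codom_f; apply/codomP => -[].
  by rewrite codom_f; apply/esym/codomP => -[].
have jiC (z : join G H) : (z \in codom inl) = (z \notin codom inr).
  by rewrite ijC negbK.
have [lt1|ge1] := ltnP m1 #|A :\: (f \o inr) @: setT|.
  exact: (@join_recol (join G H) G H inl inr _ _ x0 _ _ _ _ _ inl_inj inr_inj
    inl_hom inr_hom (fun _ _ => erefl)
    ijC can1 can2 pf fA ltA lt1).
(* At most [m1] colours of [A] are absent from [H], so [H] uses more than [m2] of them. None of
   these occurs on [G], hence [H] can go first. *)
have lt2 : m2 < #|A :\: (f \o inl) @: setT|.
  apply: (@leq_trans #|A :&: (f \o inr) @: setT|).
    by move: ltA; rewrite -(cardsID ((f \o inr) @: setT) A); lia.
  apply: subset_leq_card; apply/subsetP => z; rewrite !inE => /andP[-> /imsetP[y _ ->]].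
  rewrite andbT; apply/imsetP => -[x _ /= e].
  by have := cross _ f pf x y; rewrite e eqxx.
rewrite addnC in ltA.
have [t2 [t1 [F' [ut tA [sz2 sz1] [Fr Fl] R]]]] :=
  @join_recol (join G H) H G inr inl _ _ x0 _ _ _ _ _ inr_inj inl_inj
    inr_hom inl_hom (fun _ _ => erefl) jiC can2 can1 pf fA ltA lt2.
exists t1, t2, F'; split=> //; last by rewrite addnC.
  by rewrite uniq_catC.
by move=> z; rewrite mem_cat orbC -mem_cat; apply: tA.
Qed.

End Join.

(** * Comparable vertices *)

(** The map [h] folding the new vertex onto [v] is a homomorphism because [X] lies in the
    neighbourhood of [v]. Once the new vertex has copied the colour of [v], at the cost of one move,
    the recolouring of [G] is pulled back along [h]. *)
Lemma canonical_comparable (G : sgraph) (v : G) (X : {set G}) m (c : G -> nat) :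
  X \subset neighbours v -> canonical m c ->
  exists c' : add_vertex X -> nat, canonical m c'.
Proof.
move=> /subsetP Xv [G0 pc cm lb red].
pose h (z : option G) := if z is Some x then x else v.
have Xadj x : x \in X -> adj v x by move/Xv; rewrite inE.
have hh (x y : add_vertex X) : adj x y -> adj (h x) (h y).
  by case: x y => [x|] [y|] //= /Xadj //; rewrite adj_sym.
have cG : #|add_vertex X| = #|G|.+1 by rewrite card_option.
have ps (S : eqType) (f : add_vertex X -> S) : proper f -> proper (f \o Some).
  exact: proper_hom.
exists (c \o h); split=> [||x|C f pf|C A x0 f pf fA ltA]; rewrite ?cG //.
- exact: (@proper_hom (add_vertex X)).
- exact: cm.
- apply: leq_trans (lb _ _ (ps _ f pf)) _; apply: subset_leq_card.
  by apply/subsetP => _ /codomP[x ->]; apply: codom_f.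
have [s [us sA r]] := red C A x0 _ (ps _ f pf) (fun x => fA (Some x)) ltA.
exists s; split=> //.
have r0 : @recol (add_vertex X) _ A (fun _ => 1) f ((f \o Some) \o h).
  apply: (@recol_step (add_vertex X) _ _ _ (fun _ => 0) _ _ _ None); last exact: recol_refl.
  - by case.
  - exact: fA.
  - exact: (proper_hom hh (ps _ f pf)).
  - by move=> x; rewrite leq_b1.
by apply: recol_trans r0 (recol_hom hh (ps _ f pf) r) => x /=; lia.
Qed.

(** * Attached cliques *)

Section AttachClique.
Variables (G : sgraph) (v : G) (Q : finType).
Let K := attach_clique v Q.

Lemma attach_proper (S : eqType) (F : K -> S) :
  proper (F \o inl : G -> S) -> injective (F \o inr) ->
  (forall q, F (inr q) != F (inl v)) -> proper F.
Proof.
move=> /properP pl ir nv; apply/properP => -[x|p] [y|q] /=.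
- exact: pl.
- by move/eqP => ->; rewrite eq_sym.
- by move/eqP => ->.
- by apply: contraNneq => e; apply/eqP/ir.
Qed.

Lemma attach_properE (S : eqType) (F : K -> S) : proper F ->
  [/\ proper (F \o inl : G -> S), injective (F \o inr)
    & forall q, F (inr q) != F (inl v)].
Proof.
move=> pF; split.
- exact: proper_hom pF.
- move=> p q /= e; apply/eqP; apply: contraT => npq.
  by have := properP _ pF (inr p) (inr q) npq; rewrite e eqxx.
- by move=> q; apply: (properP _ pF); rewrite /= eqxx.
Qed.

(* When [v] is about to take the colour of a clique vertex, that vertex first
   moves to a spare colour. *)
Lemma recol_attach (C : finType) (A : {set C}) w (f g : G -> C) (F : K -> C) :
  #|Q|.+1 < #|A| -> F \o inl =1 f -> proper F -> recol A w f g ->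
  exists F' : K -> C, [/\ F' \o inl =1 g, proper F'
    & recol A (fun z : K => match z with inl x => w x | inr _ => w v end) F F'].
Proof.
move=> ltA Ff pF r; elim: r F Ff pF => {w f g} [w f g fg|w w' f f1 g u f1f Au p lw _ IH] F Ff pF.
  by exists F; split=> // [x|]; [rewrite -fg|exact: recol_refl].
have [pl ir nv] := attach_properE pF.
(* If it is [v] that moves, the clique first gives up the colour [f1 v]; each clique vertex makes at
   most one move per move of [v]. *)
suff [F0 [F0f pF0 F0u r0]] : exists F0 : K -> C, [/\ F0 \o inl =1 f, proper F0,
    u = v -> forall q, F0 (inr q) != f1 v
    & recol A (fun z : K => if z is inr _ then u == v : nat else 0) F F0].
  have [_ ir0 nv0] := attach_properE pF0.
  pose F1 (z : K) := match z with inl x => f1 x | inr q => F0 (inr q) end.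
  have pF1 : proper F1.
    apply: attach_proper => // q /=; case: (eqVneq u v) => [/F0u //|uv].
    by rewrite f1f 1?[_ == u]eq_sym // -[f v]F0f.
  have [F' [F'g pF' r']] := IH F1 (frefl _) pF1.
  exists F'; split=> //; apply: recol_trans r0 _ => [z|]; last first.
    apply: (@recol_step K _ _
      (fun z => match z with inl x => w' x + (x == u) | inr _ => w' v end)
      _ _ _ _ (inl u) _ _ pF1 _ r').
    - case=> [x|//] xu; rewrite /F1 f1f -?[f x]F0f //.
    - exact: Au.
    - by case=> x //=; rewrite addn0.
  case: z => [x|q]; first exact: lw.
  by rewrite addnC eq_sym; apply: lw.
case: (eqVneq u v) => [uv|nuv]; last first.
  by exists F; split=> //; [move/eqP; rewrite (negbTE nuv)|exact: recol_refl].
case: (pickP (fun q => F (inr q) == f1 v)) => [q /eqP Fq|noq]; last first.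
  by exists F; split=> // [_ q|]; [rewrite noq|exact: recol_refl].
(* The vertex [v] and the clique occupy [|Q|+1] colours, fewer than [A] has. *)
have /subsetPn[d dA dF] : ~~ (A \subset F (inl v) |: (F \o inr) @: setT).
  apply/negP => /subset_leq_card; rewrite cardsU1 card_imset // cardsT.
  by case: (_ \notin _); lia.
move: dF; rewrite !inE negb_or => /andP[dv dQ].
have dQn y : F (inr y) != d by apply: contraNneq dQ => <-; apply/imsetP; exists y.
pose F0 (z : K) := if z == inr q then d else F z.
have F0q : F0 (inr q) = d by rewrite /F0 eqxx.
have F0n z : z != inr q -> F0 z = F z by rewrite /F0 => /negbTE ->.
have F0r y : y != q -> F0 (inr y) = F (inr y).
  by move=> yq; apply: F0n; apply: contraNneq yq => -[->].
have pF0 : proper F0.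
  apply: attach_proper.
  - by apply/properP => x y e; apply: (properP _ pl).
  - move=> x y /=; case: (eqVneq x q) => [->|xq]; case: (eqVneq y q) => [->|yq] //.
    + by rewrite F0q F0r // => /esym/eqP; rewrite (negbTE (dQn y)).
    + by rewrite F0q F0r // => /eqP; rewrite (negbTE (dQn x)).
    + by rewrite !F0r // => /ir.
  - move=> y; rewrite [F0 (inl v)]F0n //.
    by case: (eqVneq y q) => [->|yq]; rewrite ?F0q ?F0r.
exists F0; split=> //.
- move=> _ y; case: (eqVneq y q) => [->|yq]; rewrite ?F0q ?F0r // -Fq.
    by rewrite eq_sym.
  by apply: contraNneq yq => /ir ->.
apply: (@recol_step K _ _ _ (fun _ => 0) _ _ _ (inr q) F0n _ pF0); last exact: recol_refl.
- by rewrite F0q.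
- by case=> [x|x]; rewrite ?uv ?eqxx ?leq_b1.
Qed.

Lemma canonical_attach m (c : G -> nat) :
  canonical m c -> exists c' : K -> nat, canonical (maxn m #|Q|.+1) c'.
Proof.
move=> [G0 pc cm lb red].
have cK : #|K| = #|G| + #|Q| by rewrite card_sum.
(* Since [bump (c v)] skips [c v], the clique gets the least colours other than that of [v]. *)
pose c' (z : K) := match z with inl x => c x | inr q => bump (c v) (enum_rank q) end.
have c'm z : c' z < maxn m #|Q|.+1.
  case: z => [x|q]; rewrite /c' leq_max ?cm //; apply/orP; right.
  rewrite ltnS; apply: leq_trans (ltn_ord (enum_rank q)).
  by rewrite -add1n leq_add2r leq_b1.
have pc' : proper c'.
  apply: attach_proper => [|p q /= /(can_inj (bumpK _))/val_inj/enum_rank_inj //|q /=].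
    by apply/properP => x y; apply: (properP _ pc).
  by rewrite eq_sym neq_bump.
exists c'; split=> // [|C f pf|C A x0 f pf fA].
- by rewrite cK addn_gt0 G0.
- have [pl ir nv] := attach_properE pf.
  rewrite geq_max; apply/andP; split.
    apply: leq_trans (lb _ _ pl) _; apply: subset_leq_card.
    by apply/subsetP => _ /codomP[x ->]; apply: codom_f.
  have <- : #|f (inl v) |: (f \o inr) @: setT| = #|Q|.+1.
    rewrite cardsU1 card_imset // cardsT (_ : _ \notin _) //.
    by apply/imsetP => -[q _ e]; move: (nv q); rewrite e eqxx.
  apply: subset_leq_card; apply/subsetP => z; rewrite !inE.
  by case/orP => [/eqP ->|/imsetP[q _ ->]]; apply: codom_f.
rewrite gtn_max => /andP[ltm ltQ].
have [pl _ _] := attach_properE pf.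
have [s [us sA r]] := red C A x0 _ pl (fun x => fA (inl x)) ltm.
have szs : size s = #|A| by rewrite -(card_uniqP us); apply: eq_card.
have [F1 [F1l pF1 R1]] := recol_attach ltQ (frefl _) pf r.
have F1v : F1 (inl v) = nth x0 s (c v) by rewrite -F1l.
have [_ ir _] := attach_properE pF1.
(* After [G] is reduced, the clique is permuted into place within [B], which avoids the colour of
   [v] and still has more than [|Q|] colours. *)
pose B := A :\ F1 (inl v).
have c'lt z : c' z < size s.
  by rewrite szs (leq_trans (c'm z)) // geq_max (ltnW ltm) (ltnW ltQ).
have rQ : @recol (complete Q) _ B (fun _ => 2) (F1 \o inr)
    (fun q => nth x0 s (c' (inr q))).
  apply: (@recol_inj (complete Q) _ _ _ _ ir) => [p q /eqP|q|].
  - rewrite nth_uniq // => /eqP /=.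
    by move/(can_inj (bumpK _))/val_inj/enum_rank_inj.
  - rewrite !inE F1v nth_uniq ?(c'lt (inl v)) // -sA mem_nth // andbT.
    by rewrite /= eq_sym neq_bump.
  - have : F1 (inl v) \in A by rewrite F1v -sA mem_nth // (c'lt (inl v)).
    by move=> F1A; move: ltQ; rewrite (cardsD1 (F1 (inl v)) A) F1A.
have F1B x y : y \notin codom (inr : Q -> K) -> adj (inr x : K) y -> F1 y \notin B.
  by case: y => [y _ /eqP ->|y]; rewrite ?codom_f // !inE eqxx.
have [F2 [R2 _ F2r F2l]] := @recol_embed (complete Q) K _ _ _ inr _
  (fun z => if z is inr _ then 2 else 0) _ _ (@inr_inj _ _) (fun _ _ => id)
  (subsetDl _ _) (fun _ => leqnn _) pF1 F1B rQ.
exists s; split=> //; rewrite cK.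
apply: recol_eqr (recol_trans _ R1 R2) => [[x|q]|[x|q]].
- by rewrite F2l; [exact: F1l|apply/codomP => -[]].
- exact: F2r.
- by lia.
(* A clique vertex needs [(2|G|-1) + 2] moves, which fits because [Q] is nonempty. *)
- have Q0 : 0 < #|Q| by apply/card_gt0P; exists q.
  by move: G0 Q0; lia.
Qed.

End AttachClique.

(** * All OAT graphs, and walks in the reconfiguration graph *)

Lemma OAT_canonical (G : sgraph) : OAT G -> exists m (c : G -> nat), canonical m c.
Proof.
elim=> {G} [G G1|G H _ [m1 [c1 k1]] _ [m2 [c2 k2]]|G H _ [m1 [c1 k1]] _ [m2 [c2 k2]]
  |G v X _ [m [c kc]] Xv|G v Q _ [m [c kc]]|G H _ [m [c kc]] iGH].
- by exists 1, (fun _ => 0); apply: canonical_single.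
- by eexists; apply: canonical_union k1 k2.
- by eexists; apply: canonical_join k1 k2.
- by eexists; apply: canonical_comparable Xv kc.
- by eexists; apply: canonical_attach kc.
- by eexists; apply: canonical_iso iGH kc.
Qed.

(** Moves that keep the colour are dropped; every other move is an edge of the reconfiguration graph
    and spends at least one unit of the total budget. *)
Lemma recol_path (G : sgraph) k w (f : G -> 'I_k) (g : G -> 'I_k)
    (x y : reconf k G) :
  val x =1 f -> val y =1 g -> recol setT w f g ->
  exists p, [/\ path (@adj (reconf k G)) x p, last x p = y
    & size p <= \sum_v w v].
Proof.
move=> xf yg r; elim: r x xf yg => {w f g} [w f g fg|w w' f f1 g v f1f _ p lw _ IH] x xf yg.
  exists [::]; split=> //; apply/val_inj/ffunP => v.
  by rewrite xf yg.
have pf1 : proper [ffun v => f1 v].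
  by apply/properP => a b; rewrite !ffunE; apply: (properP _ p).
pose x1 : reconf k G := exist (fun c : {ffun G -> 'I_k} => proper c) _ pf1.
have x1f : val x1 =1 f1 by move=> a; rewrite /= ffunE.
have [q [pq lq sq]] := IH x1 x1f yg.
have lts : (\sum_a w' a).+1 <= \sum_a w a.
  rewrite (bigD1 v) //= [X in _ < X](bigD1 v) //= -addSn leq_add //.
    by move: (lw v); rewrite eqxx addn1.
  by apply: leq_sum => a /negbTE av; move: (lw a); rewrite av addn0.
case: (eqVneq (f1 v) (f v)) => [e|ne].
  exists q; have -> : x = x1.
    apply/val_inj/ffunP => a; rewrite xf x1f.
    by case: (eqVneq a v) => [->|/f1f].
  by split=> //; apply: leq_trans sq (ltnW lts).
exists (x1 :: q); split=> //=; last exact: leq_ltn_trans lts.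
rewrite pq andbT /reconf_adj (_ : [set _ | _] = [set v]) ?cards1 //.
apply/setP => a; rewrite !inE xf x1f.
by case: (eqVneq a v) => [->|/f1f ->]; rewrite ?eqxx // eq_sym.
Qed.

Theorem theorem6 (G : sgraph) (n k : nat) :
  OAT G -> #|G| = n -> 0 < k -> colourable k G ->
  connected (reconf k.+1 G) /\ diameter (reconf k.+1 G) <= 4 * n ^ 2.
Proof.
move=> /OAT_canonical[m [c can]] Gn _ [S [col [Sk pcol]]].
have [G0 pc cm lb red] := can.
(* The optimality of [m] bounds it by the number of colours of [col], so [k+1] colours include a
   spare one. *)
have mk : m <= k by apply: leq_trans (lb _ _ pcol) (leq_trans (max_card _) Sk).
have ltm : m < #|[set: 'I_k.+1]| by rewrite cardsT card_ord.
have short (x y : reconf k.+1 G) : exists p,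
    [/\ path (@adj (reconf k.+1 G)) x p, last x p = y & size p <= 4 * n ^ 2].
  have inT (z : reconf k.+1 G) v : val z v \in [set: 'I_k.+1] by rewrite inE.
  (* The reduction of [x] chooses [s] and that of [y] has to meet it, so each vertex moves at most
     [(2n-1) + (2n+1) = 4n] times. *)
  have [s [us sA r1]] := red _ _ ord0 _ (valP x) (inT x) ltm.
  have r2 := recol_sym (valP y) (inT y) (canonical_recol ord0 can (valP y) (inT y) ltm us sA).
  have [|p [pp lp sp]] := recol_path (x := x) (y := y) (frefl _) (frefl _)
    (recol_trans (w := fun _ => 4 * n) _ r1 r2); first by move=> _; lia.
  exists p; split=> //; apply: leq_trans sp _.
  by rewrite sum_nat_const Gn; nia.
split; first split.
(* The canonical colouring itself shows that the reconfiguration graph is nonempty. *)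
- have pf : proper [ffun x => inord (c x) : 'I_k.+1].
    apply/properP => x y e; rewrite !ffunE; apply: contraTneq (properP _ pc _ _ e).
    have ck z : c z < k.+1 by rewrite ltnS ltnW // (leq_trans (cm z)).
    by move=> /(congr1 val); rewrite /= !inordK // => ->; rewrite eqxx.
  by apply/card_gt0P; exists (exist (fun c : {ffun G -> 'I_k.+1} => proper c) _ pf).
- by move=> x y; apply/connectP; have [p [pp <- _]] := short x y; exists p.
apply/bigmax_leqP => x _; apply/bigmax_leqP => y _.
have [p [pp lp sp]] := short x y; apply: leq_trans sp.
by apply: dist_min; apply/walkP; exists p.
Qed.
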